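(* Let $G=(\mathbf V\sqcup\mathbf U,\mathbf E)$ be a DAG with observed variables $\mathbf V$ and latent variables $\mathbf U$, and let $\mathbf X,\mathbf Y,\mathbf Z\subset\mathbf V$ be disjoint. Suppose that (i) there are no back-door paths from $\mathbf X$ to $\mathbf Z$ in $G$ that are open (given the empty set); (ii) there are no proper front-door paths from $\mathbf X$ to $\mathbf Y$ in $G$ that are open given $\mathbf Z$. Then for every joint distribution $P(\mathbf v,\mathbf u)$ that factorizes according to $G$ and whose observed distribution $P(\mathbf v)$ is strictly positive, and for all values $\mathbf x^*$ of $\mathbf X$ and $\mathbf y$ of $\mathbf Y$, $$P(\mathbf y\mid \operatorname{do}(\mathbf x:=\mathbf x^* ))=\sum_{\mathbf z}P(\mathbf z\mid\mathbf x^* )\sum_{\mathbf x}P(\mathbf y\mid\mathbf z,\mathbf x)P(\mathbf x).$$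
   Context: Setting. A DAG is a graph with directed edges and no directed cycles. Each node of $G=(\mathbf V\sqcup\mathbf U,\mathbf E)$ is a discrete random variable; nodes in $\mathbf V$ are observed, nodes in $\mathbf U$ are latent. Boldface denotes sets of variables, lower-case letters denote values. A joint distribution $P(\mathbf v,\mathbf u)$ factorizes according to $G$ if $P(\mathbf v,\mathbf u)=\prod_{w\in\mathbf V\sqcup\mathbf U}P(w\mid Pa(w))$, where $Pa(w)$ is the set of parents of $w$ in $G$. The observed distribution is $P(\mathbf v)=\sum_{\mathbf u}P(\mathbf v,\mathbf u)$. Standing assumption: $P(\mathbf v)>0$ for all $\mathbf v$ in the domain of $\mathbf V$. Interventions. With the same conditional factors $P(w\mid Pa(w))$, the interventional distribution is $P(\mathbf v\mid\operatorname{do}(\mathbf X=\mathbf x^* ))=\sum_{\mathbf u}\prod_{w\in(\mathbf V\sqcup\mathbf U)\setminus\mathbf X}P(w\mid Pa(w))\cdot\mathbb 1_{\mathbf x=\mathbf x^*}$, and $P(\mathbf y\mid\operatorname{do}(\mathbf x:=\mathbf x^* ))$ (also written $P_{\mathbf X}(\mathbf y)$) is its marginal on $\mathbf Y$. Paths. A path is a sequence of distinct nodes with consecutive nodes joined by an edge of either direction; a path from a set to a set is a path from some node of the first to some node of the second. A path from a node $X$ is front-door if its first edge points away from $X$ ($X\to\cdots$); all other paths from $X$ are back-door. A path from $\mathbf X$ to $\mathbf Y$ is proper if its only node in $\mathbf X$ is its first node. An interior node of a path is a collider if both path edges adjacent to it point towards it, and a non-collider otherwise. A path is open given a set $\mathbf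 Z$ if no non-collider (interior node) on it is in $\mathbf Z$ and every collider on it is in $An(\mathbf Z)$, the set of ancestors of $\mathbf Z$ in $G$ (with $\mathbf Z\subseteq An(\mathbf Z)$). *)

(* Defs.v *)
From HB Require Import structures.
From mathcomp Require Import all_boot all_order all_algebra.
From mathcomp Require Import all_classical all_reals ereal esum.

Set Implicit Arguments.
Unset Strict Implicit.
Unset Printing Implicit Defensive.

Import Order.TTheory GRing.Theory Num.Theory.

Local Open Scope ring_scope.
Local Open Scope ereal_scope.

(* A graph is a finite type of nodes N with a directed edge relation e, where
   e u v means u -> v. The observed nodes form a set V : {set N}; the latent
   nodes are its complement. *)

Definition acyclic (N : finType) (e : rel N) : Prop :=
  forall c : seq N, c != [::] -> ~~ cycle e c.

Definition parents (N : finType) (e : rel N) (w : N) : {set N} :=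
  [set v : N | e v w]%SET.

Definition ancestors (N : finType) (e : rel N) (Z : {set N}) : {set N} :=
  [set v : N | [exists z in Z, connect e v z]]%SET.

Definition adjacent (N : finType) (e : rel N) : rel N :=
  fun u v => e u v || e v u.

(* In an acyclic graph at most one edge joins two given nodes, so a path is
   determined by its nodes x :: p. *)
Definition is_path (N : finType) (e : rel N) (x : N) (p : seq N) : bool :=
  path (adjacent e) x p && uniq (x :: p).

Definition path_between (N : finType) (e : rel N) (A B : {set N})
    (x : N) (p : seq N) : bool :=
  [&& is_path e x p, x \in A & last x p \in B].

Definition front_door (N : finType) (e : rel N) (x : N) (p : seq N) : bool :=
  if p is v :: _ then e x v else false.

Definition back_door (N : finType) (e : rel N) (x : N) (p : seq N) : bool :=
  ~~ front_door e x p.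

Definition proper_path (N : finType) (A : {set N}) (p : seq N) : bool :=
  all (fun v => v \notin A) p.

Definition collider (N : finType) (e : rel N) (a b c : N) : bool :=
  e a b && e c b.

(* The interior nodes of a path s are the middle entries b of its contiguous
   subsequences [:: a; b; c]. *)
Definition open_given (N : finType) (e : rel N) (Z : {set N}) (s : seq N) :
    Prop :=
  forall a b c : N, infix [:: a; b; c] s ->
    if collider e a b c then b \in ancestors e Z else b \notin Z.

(* Node w takes values in the countable type D w. *)
Definition assignment (N : finType) (D : N -> countType) : Type :=
  {dffun forall w : N, D w}.

Definition values (N : finType) (D : N -> countType) (S : {set N}) : Type :=
  {dffun forall i : {w : N | w \in S}, D (val i)}.

HB.instance Definition _ (N : finType) (D : N -> countType) :=
  Countable.copy (assignment D) {dffun forall w : N, D w}.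

HB.instance Definition _ (N : finType) (D : N -> countType) (S : {set N}) :=
  Countable.copy (values D S)
    {dffun forall i : {w : N | w \in S}, D (val i)}.

Definition restrict (N : finType) (D : N -> countType) (S : {set N})
    (a : assignment D) : values D S :=
  [ffun i : {w : N | w \in S} => a (val i)].

Definition distribution_on (R : realType) (T : choiceType) (p : T -> R) :
    Prop :=
  (forall t : T, (0 <= p t)%R) /\ \esum_(t in [set: T]) (p t)%:E = 1.

Definition mass (R : realType) (N : finType) (D : N -> countType)
    (P : assignment D -> R) (E : set (assignment D)) : \bar R :=
  \esum_(a in E) (P a)%:E.

Definition event (N : finType) (D : N -> countType) (S : {set N})
    (s : values D S) : set (assignment D) :=
  [set a | restrict S a = s]%classic.

Definition marginal (R : realType) (N : finType) (D : N -> countType)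
    (P : assignment D -> R) (S : {set N}) (s : values D S) : \bar R :=
  mass P (event s).

(* Meaningful when F has positive mass: in \bar R the inverse of 0 is +oo. *)
Definition cond (R : realType) (N : finType) (D : N -> countType)
    (P : assignment D -> R) (E F : set (assignment D)) : \bar R :=
  mass P (E `&` F)%classic / mass P F.

Definition factors (R : realType) (N : finType) (e : rel N)
    (D : N -> countType) : Type :=
  forall w : N, values D (parents e w) -> D w -> R.

(* k w is a version of the conditional distribution P(w | Pa(w)): the ratio
   P(w, pa) / P(pa) whenever P(pa) > 0. Parent values of probability zero are
   possible (only P(v) is assumed positive) and still matter under an
   intervention; there k w is an arbitrary probability distribution. *)
Definition conditional_factors (R : realType) (N : finType) (e : rel N)
    (D : N -> countType) (P : assignment D -> R) (k : factors R e D) : Prop :=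
  forall (w : N) (pa : values D (parents e w)),
    distribution_on (k w pa) /\
    forall d : D w, 0 < marginal P pa ->
      (k w pa d)%:E = cond P [set a | a w = d]%classic (event pa).

Definition factor_at (R : realType) (N : finType) (e : rel N)
    (D : N -> countType) (k : factors R e D) (a : assignment D) (w : N) : R :=
  k w (restrict (parents e w) a) (a w).

Definition factorizes (R : realType) (N : finType) (e : rel N)
    (D : N -> countType) (P : assignment D -> R) (k : factors R e D) : Prop :=
  conditional_factors P k /\
  forall a : assignment D, P a = (\prod_(w : N) factor_at k a w)%R.

(* The summand of P(v | do(X = x)), before summing out the latent nodes. *)
Definition do_joint (R : realType) (N : finType) (e : rel N)
    (D : N -> countType) (k : factors R e D) (X : {set N}) (x : values D X)
    (a : assignment D) : R :=
  (if restrict X a == x then \prod_(w : N | w \notin X) factor_at k a w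
   else 0)%R.

Definition do_marginal (R : realType) (N : finType) (e : rel N)
    (D : N -> countType) (k : factors R e D) (X : {set N}) (x : values D X)
    (Y : {set N}) (y : values D Y) : \bar R :=
  marginal (do_joint k x) y.

(* Main.v *)
Require Import Defs.
From HB Require Import structures.
From mathcomp Require Import all_boot all_order all_algebra.
From mathcomp Require Import all_classical all_reals ereal esum.
From mathcomp Require Import ring.

Set Implicit Arguments.
Unset Strict Implicit.
Unset Printing Implicit Defensive.

Import Order.TTheory GRing.Theory Num.Theory.

Local Open Scope ring_scope.
Local Open Scope ereal_scope.

(** Write the joint law as the product of the factors k w, and call summing a
function over the values of a set of nodes summing out that set. The one
analytic tool is [sum_out_barren]: a set of nodes no other node of the product
has as a parent contributes nothing once summed out, since its factors sum to
1. What remains is to find out which factors share variables.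

Let A be the ancestors of X, and B the nodes that have a directed path to Z
avoiding X. Condition (i) makes A and B disjoint
([ancestors_avoiding_disjoint]): from a common node, going up to X and down to
Z would give an open back-door path. As the parents of B lie in B and X, the
joint law of (x, z) is P(x) times the mass of B given x, and the latter is
P(z | do(x)) ([mediator_unconfounded]).

Let H be the nodes outside Z that have a directed path to Y or Z avoiding X and
are joined to Y by a walk open given Z and avoiding X ([response]). If the
factor of a node of B or H involved both a node of H and a node of X, the walk
could be extended, or rerouted along a directed path to Y, into an open walk
that leaves X through a front door; loops can be cut out of an open walk
([open_walk_to_path]), so this would contradict condition (ii). Hence, among
these factors, those that touch H involve only H and Z, and the others involve
only X and B outside H. The do-distribution of (y, z) therefore splits as
r(y, z) m(x, z), with r the mass of the factors touching H and m that of the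
other factors of B ([truncated_sum_out]), and P(z | do(x)) = r(z) m(x, z).

In the observed law the factors of A outside H are also present. They involve
only nodes of A, none of which is in B, so P(x, y, z) = o(x, y, z) m(x, z) with
the same m ([joint_sum_out]); and they form a barren set, so summing o over x
gives back r(y, z) ([sum_out_observed_mass]). Thus
   sum over x of P(y | z, x) P(x) = sum over x of o(x, y, z) / r(z)
                                  = r(y, z) / r(z),
and multiplying by P(z | x) = r(z) m(x, z) gives P(y, z | do(x)). *)

(** * Sums over the values of a set of nodes *)

(** The scalar may be infinite: the sums pulled out later on are masses of
partial products of factors, not known to be finite at that point. *)
Lemma esumZl (R : realType) (T : choiceType) (I : set T) (c : \bar R)
    (a : T -> \bar R) :
  0 <= c -> (forall i, 0 <= a i) ->
  \esum_(i in I) (c * a i) = c * \esum_(i in I) a i.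
Proof.
move=> c0 a0.
have lower (b : R) f : (0 <= b)%R -> (forall i, 0 <= f i) ->
    \esum_(i in I) (b%:E * f i) <= b%:E * \esum_(i in I) f i.
  move=> b0 f0; rewrite ge_ereal_sup => //= _ [J [finJ JI]] <-.
  rewrite -ge0_mule_fsumr => [|i]; last exact: f0.
  by apply: lee_wpmul2l => //; apply: esum_ge; exists J.
case: c c0 => [r||] // r0.
  apply/eqP; rewrite eq_le lower //=.
  have [->|rn0] := eqVneq r 0%R.
    by rewrite mul0e; apply: esum_ge0 => i _; rewrite mul0e.
  have rp : (0 < r)%R by rewrite lt0r rn0.
  rewrite -[leRHS]mul1e -(divff rn0) EFinM -muleA lee_pmul2l ?lte_fin//.
  apply: (le_trans _ (lower r^-1%R _ _ _)).
  - by apply: le_esum => i _; rewrite muleA -EFinM mulVf // mul1e.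
  - by rewrite invr_ge0.
  - by move=> i; apply: mule_ge0.
have [aI0|] := pselect (forall i, I i -> a i = 0).
  by rewrite !esum1 ?mule0// => i Ii; rewrite aI0 // mule0.
move=> /existsNP [i /not_implyP[Ii /eqP ai0]].
have aip : 0 < a i by rewrite lt0e ai0 a0.
have single (f : T -> \bar R) :
    (forall j, 0 <= f j) -> f i <= \esum_(j in I) f j.
  move=> f0; apply: esum_ge; exists [set i]%classic; last by rewrite fsbig_set1.
  by split => // j ->.
have -> : ((+oo : \bar R) * (\esum_(i in I) a i) = +oo)%E.
  by rewrite gt0_mulye // (lt_le_trans aip) // single.
apply/eqP; rewrite eq_le leey /= -[leLHS](gt0_mulye aip).
by apply: (single (fun j => +oo * a j)%E) => j; apply: mule_ge0.
Qed.

Section Assignments.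
Variables (N : finType) (D : N -> countType).
Implicit Types (S T : {set N}) (a b : assignment D).

Definition overwrite S (s : values D S) a : assignment D :=
  [ffun w =>
    if decP (@idP (w \in S)) is left wS then s (exist _ w wS) else a w].

Lemma overwriteT S (s : values D S) a w (wS : w \in S) :
  overwrite s a w = s (exist _ w wS).
Proof.
by rewrite ffunE; case: (decP _) => // wS'; rewrite (bool_irrelevance wS' wS).
Qed.

Lemma overwriteF S (s : values D S) a w : w \notin S -> overwrite s a w = a w.
Proof. by rewrite ffunE; case: (decP _) => // wS /negP. Qed.

Lemma overwriteK S (s : values D S) a : Defs.restrict S (overwrite s a) = s.
Proof. by apply/ffunP => -[w wS]; rewrite ffunE /= overwriteT. Qed.

Lemma restrictP S a b :
  Defs.restrict S a = Defs.restrict S b <-> {in S, forall w, a w = b w}.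
Proof.
split=> [ab w wS|ab]; last by apply/ffunP => -[w wS]; rewrite !ffunE ab.
by move/ffunP/(_ (exist _ w wS)): ab; rewrite !ffunE.
Qed.

Lemma restrict_overwrite S T (s : values D S) a : [disjoint S & T] ->
  Defs.restrict T (overwrite s a) = Defs.restrict T a.
Proof.
move=> dST; apply/restrictP => w wT.
by rewrite overwriteF // (disjointFl dST wT).
Qed.

Definition agree S a : set (assignment D) :=
  [set b | {in S, forall w, b w = a w}]%classic.

Lemma event_restrict S a : event (Defs.restrict S a) = agree S a.
Proof. by apply/seteqP; split=> b /restrictP. Qed.

End Assignments.

Section SumOut.
Variables (R : realType) (N : finType) (D : N -> countType).
Implicit Types (S T : {set N}) (a b : assignment D).
Implicit Types (f g : assignment D -> \bar R).

(** The result is again a function of all coordinates, constant in those of S;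
this spares the bookkeeping of functions on varying sets of coordinates. *)
Definition sum_out S f a : \bar R :=
  \esum_(s in [set: values D S]) f (overwrite s a).

Definition depends_on T f :=
  forall a b, {in T, forall w, a w = b w} -> f a = f b.

Lemma sum_out_agree S f a :
  sum_out S f a = \esum_(b in agree (~: S) a) f b.
Proof.
rewrite (@reindex_esum _ _ _ [set: values D S] _ (fun s => overwrite s a)) //.
split=> [s _ w|s t _ _ st|b ba].
- by rewrite inE => wS; rewrite overwriteF.
- by rewrite -(overwriteK s a) st overwriteK.
exists (Defs.restrict S b) => //; apply/ffunP => w.
have [wS|wS] := boolP (w \in S); first by rewrite overwriteT ffunE.
by rewrite overwriteF // ba // inE.
Qed.

Lemma sum_out_ge0 S f a : (forall b, 0 <= f b) -> 0 <= sum_out S f a.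
Proof. by move=> f0; apply: esum_ge0. Qed.

Lemma eq_sum_out S f g : f =1 g -> sum_out S f =1 sum_out S g.
Proof. by move=> fg a; apply: eq_esum => s _. Qed.

Lemma depends_onW S T f : S \subset T -> depends_on S f -> depends_on T f.
Proof.
by move=> ST fS a b ab; apply: fS => w /(fintype.subsetP ST); apply: ab.
Qed.

Lemma depends_on_sum_out S T f :
  depends_on T f -> depends_on (T :\: S) (sum_out S f).
Proof.
move=> fT a b ab; apply: eq_esum => s _; apply: fT => w wT.
have [wS|wS] := boolP (w \in S); first by rewrite !overwriteT.
by rewrite !overwriteF // ab // inE wS.
Qed.

Lemma sum_out0 f a : 0 <= f a -> sum_out finset.set0 f a = f a.
Proof.
move=> fa0; rewrite sum_out_agree -(esum_set1 fa0); congr esum.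
apply/seteqP; split=> [b ba|_ -> //].
by apply/ffunP => w; rewrite ba // !inE.
Qed.

Lemma sum_outU S T f a : [disjoint S & T] -> (forall b, 0 <= f b) ->
  sum_out (S :|: T) f a = sum_out S (sum_out T f) a.
Proof.
move=> dST f0; rewrite sum_out_agree.
transitivity (\esum_(s in [set: values D S])
  \esum_(b in agree (~: T) (overwrite s a)) f b);
  last by apply: eq_esum => s _; rewrite -sum_out_agree.
rewrite esum_esum //; apply: (@reindex_esum _ _ _ _ _ snd); split.
- move=> [s b] /= [_ bs] w; rewrite !inE negb_or => /andP[wS wT].
  by rewrite bs ?inE // overwriteF.
- move=> [s b] [t c] /set_mem[_ /= bs] /set_mem[_ /= ct] bc.
  congr (_, _) => //; rewrite -(overwriteK s a) -(overwriteK t a).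
  apply/restrictP => w wS.
  by rewrite -bs -?ct ?bc // inE (disjointFr dST wS).
- move=> b ba; exists (Defs.restrict S b, b) => //=; split=> // w.
  rewrite inE => wT; have [wS|wS] := boolP (w \in S).
    by rewrite overwriteT ffunE.
  by rewrite overwriteF // ba // !inE negb_or wS.
Qed.

Lemma sum_out_mull S T f g a : depends_on T f -> [disjoint S & T] ->
  (forall b, 0 <= f b) -> (forall b, 0 <= g b) ->
  sum_out S (fun b => f b * g b) a = f a * sum_out S g a.
Proof.
move=> fT dST f0 g0; rewrite -esumZl //; apply: eq_esum => s _; congr (_ * _).
by apply: fT => w wT; rewrite overwriteF // (disjointFl dST wT).
Qed.

Lemma sum_out_mulr S T f g a : depends_on T g -> [disjoint S & T] ->
  (forall b, 0 <= f b) -> (forall b, 0 <= g b) ->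
  sum_out S (fun b => f b * g b) a = sum_out S f a * g a.
Proof.
move=> gT dST f0 g0; rewrite muleC -(sum_out_mull _ gT) //.
by apply: eq_sum_out => b; rewrite muleC.
Qed.

(** This is where a product law is turned into independence: two factors with no
summed coordinate in common can be summed separately. *)
Lemma sum_out_mul S1 S2 T1 T2 f g a : depends_on T1 f -> depends_on T2 g ->
  [disjoint S1 & S2] -> [disjoint S1 & T2] -> [disjoint S2 & T1] ->
  (forall b, 0 <= f b) -> (forall b, 0 <= g b) ->
  sum_out (S1 :|: S2) (fun b => f b * g b) a = sum_out S1 f a * sum_out S2 g a.
Proof.
move=> fT gT dS dST dTS f0 g0.
rewrite sum_outU // => [|b]; last exact: mule_ge0.
transitivity (sum_out S1 (fun b => f b * sum_out S2 g b) a).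
  by apply: eq_sum_out => b; apply: (sum_out_mull _ fT).
apply: (@sum_out_mulr _ (T2 :\: S2)) => //; first exact: depends_on_sum_out.
- exact: fintype.disjointWr (finset.subsetDl _ _) dST.
- by move=> b; apply: sum_out_ge0.
Qed.

Lemma mass_agree (P : assignment D -> R) S a :
  mass P (agree S a) = sum_out (~: S) (EFin \o P) a.
Proof. by rewrite sum_out_agree finset.setCK. Qed.

End SumOut.

(** * Products of factors *)

Lemma acyclic_connect (N : finType) (e : rel N) u v :
  acyclic e -> e u v -> ~~ connect e v u.
Proof.
move=> acyc uv; apply/negP => /connectP[p vp up].
by have /negP[] := acyc (v :: p) isT; rewrite /= rcons_path vp -up.
Qed.

(** A node of S with the fewest descendants has no child in S. *)
Lemma acyclic_sink (N : finType) (e : rel N) (S : {set N}) :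
  acyclic e -> S != finset.set0 ->
  exists2 w, w \in S & forall u, e w u -> u \notin S.
Proof.
move=> acyc /set0Pn[w0 w0S].
case: (arg_minnP (fun w => #|connect e w|) w0S) => w wS wmin.
exists w => // u wu; apply/negP => /wmin; apply/negP; rewrite -ltnNge.
apply: proper_card; apply/properP; split.
  by apply/fintype.subsetP => v; rewrite !inE; apply/connect_trans/connect1.
by exists w; rewrite !inE ?connect0 // acyclic_connect.
Qed.

Section Factors.
Variables (R : realType) (N : finType) (e : rel N) (D : N -> countType).
Variable k : factors R e D.
Hypothesis e_acyclic : acyclic e.
Hypothesis k_distribution : forall w pa, distribution_on (@k w pa).
Implicit Types (S T W : {set N}) (a b : assignment D).

Definition factor_prod T a : \bar R := (\prod_(w in T) factor_at k a w)%:E.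

Lemma factor_prod_ge0 T a : 0 <= factor_prod T a.
Proof.
rewrite lee_fin prodr_ge0 // => w _.
by have [+ _] := @k_distribution w (Defs.restrict (parents e w) a); apply.
Qed.

Lemma factor_prodU S T a : [disjoint S & T] ->
  factor_prod (S :|: T) a = factor_prod S a * factor_prod T a.
Proof.
move=> dST; rewrite -EFinM -bigU //; congr EFin.
by apply: eq_bigl => w; rewrite !inE.
Qed.

Definition closed_under_parents T S :=
  forall w, w \in T -> parents e w \subset S.

Lemma depends_on_factor_prod T S : T \subset S -> closed_under_parents T S ->
  depends_on S (factor_prod T).
Proof.
move=> TS paS a b ab; congr EFin; apply: eq_bigr => w wT.
rewrite /factor_at ab; last exact: (fintype.subsetP TS).
congr (@k _ _ _); apply/restrictP => u uw; apply: ab.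
exact: (fintype.subsetP (paS _ wT)).
Qed.

Lemma sum_out_factor w a : sum_out [set w]%SET (factor_prod [set w]%SET) a = 1.
Proof.
have [_ <-] := @k_distribution w (Defs.restrict (parents e w) a).
rewrite (@reindex_esum _ _ _ [set: values D [set w]%SET] _
  (fun s => s (exist _ w (set11 w)))) //.
  apply: eq_esum => s _; rewrite /factor_prod big_set1 /factor_at.
  rewrite (overwriteT _ _ (set11 w)).
  congr EFin; congr (@k _ _ _); apply/restrictP => u; rewrite inE => uw.
  rewrite overwriteF // inE; apply: contraTneq uw => ->.
  by apply/negP => /(acyclic_connect e_acyclic); rewrite connect0.
split=> // [s t _ _ st|d _].
  apply/ffunP => -[u uw]; have uw' := finset.set1P uw; subst u.
  by rewrite (bool_irrelevance uw (set11 w)).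
exists [ffun i =>
  eq_rect w (fun u => D u) d (val i) (esym (finset.set1P (valP i)))] => //.
by rewrite ffunE eq_axiomK.
Qed.

(** Sum out a sink of W first: no other factor of W depends on it. *)
Lemma sum_out_factor_prod W a : sum_out W (factor_prod W) a = 1.
Proof.
have [n] := ubnP #|W|; elim: n => // n IH in W a *; rewrite ltnS => leWn.
have [->|Wn0] := eqVneq W finset.set0.
  by rewrite sum_out0 ?factor_prod_ge0 // /factor_prod big_set0.
have [w wW sink] := acyclic_sink e_acyclic Wn0.
have dW : [disjoint W :\ w & [set w]%SET].
  by rewrite disjoint_sym finset.disjoints1 !inE eqxx.
have EW : W = (W :\ w) :|: [set w]%SET by rewrite finset.setUC finset.setD1K.
rewrite [X in sum_out X]EW sum_outU //; last exact: factor_prod_ge0.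
rewrite -[RHS](IH (W :\ w) a); last first.
  by apply: leq_trans leWn; rewrite [in leqRHS](cardsD1 w) wW.
apply: eq_sum_out => b; rewrite -[RHS]mule1 -(sum_out_factor w b).
rewrite (@eq_sum_out _ _ _ _ _
  (fun c => factor_prod (W :\ w) c * factor_prod [set w]%SET c)); last first.
  by move=> c; rewrite -factor_prodU // -EW.
apply: (@sum_out_mull _ _ _ _ (~: [set w]%SET)); try exact: factor_prod_ge0.
  apply: depends_on_factor_prod => [|u].
    by rewrite -finset.disjoints_subset.
  rewrite !inE => /andP[_ uW]; apply/fintype.subsetP => v; rewrite !inE => vu.
  by apply: contraTneq uW => vw; apply: sink; rewrite -vw.
by rewrite finset.disjoints_subset finset.setCK.
Qed.

(** Nodes that are parents of no other node in the product can be dropped from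
both the sum and the product: the other factors do not depend on them, and
their own factors sum to 1. *)
Lemma sum_out_barren W S T a :
  W \subset S -> W \subset T ->
  (forall w, w \in T :\: W -> [disjoint parents e w & W]) ->
  sum_out S (factor_prod T) a = sum_out (S :\: W) (factor_prod (T :\: W)) a.
Proof.
move=> WS WT barren.
have ED (U : {set N}) : W \subset U -> U = (U :\: W) :|: W.
  by move=> WU; rewrite finset.setUC -{1}(finset.setIidPr WU) finset.setID.
have dD (U : {set N}) : [disjoint U :\: W & W].
  by rewrite finset.disjoints_subset finset.setDE finset.subsetIr.
rewrite [X in sum_out X](ED _ WS) sum_outU //; last exact: factor_prod_ge0.
apply: eq_sum_out => b; rewrite -[RHS]mule1 -(sum_out_factor_prod W b).
rewrite (@eq_sum_out _ _ _ _ _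
  (fun c => factor_prod (T :\: W) c * factor_prod W c)); last first.
  by move=> c; rewrite -factor_prodU // -ED.
apply: (@sum_out_mull _ _ _ _ (~: W)); try exact: factor_prod_ge0.
  apply: depends_on_factor_prod => [|u uTW].
    by rewrite -finset.disjoints_subset.
  by rewrite -finset.disjoints_subset barren.
by rewrite finset.disjoints_subset finset.setCK.
Qed.

End Factors.

(** * Open walks *)

Section Graph.
Variables (N : finType) (e : rel N).
Hypothesis e_acyclic : acyclic e.
Implicit Types (X Y Z T : {set N}) (s p q : seq N).

Lemma no_two_cycle u v : e u v -> ~~ e v u.
Proof.
move=> uv; apply: contra (acyclic_connect e_acyclic uv); exact: connect1.
Qed.

Definition triple_open Z a b c : Prop :=
  if collider e a b c then b \in ancestors e Z else b \notin Z.

Lemma open_given_short Z s : (size s < 3)%N -> open_given e Z s.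
Proof.
move=> short a b c /size_infix long.
by have := leq_trans short long; rewrite ltnn.
Qed.

Lemma open_given_infix Z s s' : infix s s' ->
  open_given e Z s' -> open_given e Z s.
Proof. by move=> ss' op a b c abc; apply: op; apply: infix_trans ss'. Qed.

Lemma open_given_cons Z x y z s :
  open_given e Z (x :: y :: z :: s) <->
  triple_open Z x y z /\ open_given e Z (y :: z :: s).
Proof.
split=> [op|[xyz op] a b c].
  split; first by apply: op; rewrite infix_consl /= !eqxx prefix0s.
  by apply: open_given_infix op; apply: infix_cons.
rewrite infix_consl => /orP[|/op //].
by rewrite /= => /and3P[/eqP-> /eqP-> /andP[/eqP-> _]].
Qed.

Lemma open_given_splice Z x p v q :
  open_given e Z (rcons (x :: p) v) -> open_given e Z (v :: q) ->
  (forall c, ohead q = Some c -> triple_open Z (last x p) v c) ->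
  open_given e Z (x :: p ++ v :: q).
Proof.
elim: p x => [|y p IH] x /= op opq junction.
  case: q opq junction => [|c q] opq junction; first exact: open_given_short.
  by apply/open_given_cons; split=> //; apply: junction.
case: p op IH junction => [|z p] op IH junction.
  move/open_given_cons: op => [xyv op].
  by apply/open_given_cons; split=> //; apply: IH.
move/open_given_cons: op => [xyz op].
by apply/open_given_cons; split=> //; apply: IH.
Qed.

Lemma parent_ancestors Z u v :
  e u v -> v \in ancestors e Z -> u \in ancestors e Z.
Proof.
move=> uv; rewrite !inE => /exists_inP[z zZ vz].
apply/exists_inP; exists z => //.
exact: connect_trans (connect1 uv) vz.
Qed.

(** A walk that leaves u along an arrow and ends against an arrow has a
collider; the first one is a descendant of u, and as the walk is open it lies
above Z. *)
Lemma open_given_turning Z u w q :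
  path (adjacent e) u (w :: q) -> open_given e Z (u :: w :: q) ->
  e u w -> e (last w q) (last u (belast w q)) -> u \in ancestors e Z.
Proof.
elim: q u w => [|c q IH] u w /=.
  by move=> _ _ uw; rewrite (negPf (no_two_cycle uw)).
move=> /and3P[adj_uw adj_wc wq] /open_given_cons[uwc op] uw back.
apply: (parent_ancestors uw); move: uwc; rewrite /triple_open /collider uw /=.
have [//|ncw _] := boolP (e c w).
apply: IH op _ back; first by rewrite /= adj_wc.
by move: adj_wc; rewrite /adjacent (negPf ncw) orbF.
Qed.

(** Cutting a loop at v keeps a walk open. If v is a non-collider after the cut,
one of its two remaining edges points out of v, so v was a non-collider at the
corresponding visit before the cut. If v becomes a collider without having
been one, the loop leaves v and comes back to it against arrows, and
[open_given_turning] puts v above Z. *)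
Lemma open_given_shortcut Z x p1 v p2 p3 :
  path (adjacent e) x (p1 ++ v :: p2 ++ v :: p3) ->
  open_given e Z (x :: p1 ++ v :: p2 ++ v :: p3) ->
  open_given e Z (x :: p1 ++ v :: p3).
Proof.
move=> walk op.
have sub s s1 s2 : s1 ++ s ++ s2 = x :: p1 ++ v :: p2 ++ v :: p3 ->
    open_given e Z s.
  by move=> E; apply: open_given_infix op; rewrite -E; apply: infix_infix.
apply: open_given_splice.
- by apply: (sub _ [::] (p2 ++ v :: p3)); rewrite /= cat_rcons.
- by apply: (sub _ (x :: p1 ++ v :: p2) [::]); rewrite cats0 /= -catA.
case: p3 => [|c p3] // in walk op sub * => _ [<-].
move: walk; rewrite cat_path /= cat_path /=.
case: p2 => [|b p2] in op sub *.
  rewrite /= /adjacent => /and5P[_ _ vv _ _].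
  have {}vv : e v v by case/orP: vv.
  by have := no_two_cycle vv; rewrite vv.
move=> /and4P[_ _ vp2 /and3P[dv _ _]].
have avb : triple_open Z (last x p1) v b.
  apply: (sub _ (belast x p1) (p2 ++ v :: c :: p3) _ _ _ _ (infix_refl _)).
  by rewrite -[RHS]cat_cons (lastI x p1) cat_rcons.
have dvc : triple_open Z (last b p2) v c.
  apply: (sub _ (x :: p1 ++ v :: belast b p2) p3 _ _ _ _ (infix_refl _)).
  by rewrite (lastI b p2) cat_rcons /= -catA.
have loop : open_given e Z (v :: b :: rcons p2 v).
  by apply: (sub _ (x :: p1) (c :: p3)); rewrite /= cat_rcons.
rewrite /triple_open /collider in avb dvc *.
have [/andP[av cv]|] := boolP (e (last x p1) v && e c v); last first.
  rewrite negb_and => /orP[/negPf av|/negPf cv].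
    by move: avb; rewrite av.
  by move: dvc; rewrite cv andbF.
rewrite av /= in avb; rewrite cv andbT in dvc.
have [bv|nbv] := boolP (e b v); first by rewrite bv in avb.
have [dv'|ndv] := boolP (e (last b p2) v); first by rewrite dv' in dvc.
move: vp2 => /= /andP[vb bp2].
apply: (open_given_turning _ loop).
- by rewrite /= vb rcons_path bp2.
- by move: vb; rewrite /adjacent (negPf nbv) orbF.
- rewrite last_rcons belast_rcons /=.
  by move: dv; rewrite /adjacent /= (negPf ndv).
Qed.

Lemma nuniq_split p :
  ~~ uniq p -> exists p1 v p2 p3, p = p1 ++ v :: p2 ++ v :: p3.
Proof.
elim: p => //= v p IH; rewrite negb_and negbK => /orP[|/IH].
  by case/splitPr => p2 p3; exists [::], v, p2, p3.
by move=> [p1 [u [p2 [p3 ->]]]]; exists (v :: p1), u, p2, p3.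
Qed.

(** Whether the path is front-door is preserved: as x does not recur, every loop
that is cut lies beyond the first edge. *)
Lemma open_walk_to_path Z x p :
  path (adjacent e) x p -> x \notin p -> open_given e Z (x :: p) ->
  exists p', [/\ is_path e x p', last x p' = last x p, ohead p' = ohead p,
    {subset p' <= p} & open_given e Z (x :: p')].
Proof.
have [n] := ubnP (size p); elim: n p => // n IH p; rewrite ltnS => size_p.
move=> walk xp op; have [up|] := boolP (uniq p).
  by exists p; split=> //; rewrite /is_path walk /= xp.
move=> /nuniq_split[p1 [v [p2 [p3 Ep]]]].
rewrite {p}Ep in size_p walk xp op *.
have [||||p' [path' last' head' sub' op']] := IH (p1 ++ v :: p3).
- apply: leq_trans size_p; rewrite !size_cat /= size_cat /=.
  by rewrite ltn_add2l ltnS leq_addl.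
- by move: walk; rewrite !cat_path /= cat_path /= => /and5P[-> -> _ _ ->].
- by apply: contra xp; rewrite !(mem_cat, inE) => /or3P[]->; rewrite ?orbT.
- exact: open_given_shortcut op.
exists p'; split=> //.
- by rewrite last' !last_cat /= last_cat.
- by rewrite head'; case: (p1).
- by move=> w /sub'; rewrite !(mem_cat, inE) => /or3P[]->; rewrite ?orbT.
Qed.

(** * Directed paths *)

(** The whole path avoids X, both ends included. *)
Definition avoiding_ancestors (X T : {set N}) : {set N} :=
  [set w | (w \notin X) &&
    [exists t in T, connect (fun u v => e u v && (v \notin X)) w t]]%SET.

Lemma avoiding_ancestorsP X T w :
  reflect (exists p, [/\ path e w p, all (fun v => v \notin X) (w :: p)
                        & last w p \in T])
          (w \in avoiding_ancestors X T).
Proof.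
have pathE u p : path (fun u v => e u v && (v \notin X)) u p =
    path e u p && all (fun v => v \notin X) p.
  elim: p u => //= v p IH u; rewrite IH.
  by case: (e u v) => //=; case: (v \notin X) => //=; rewrite andbF.
rewrite inE; apply: (iffP andP) => [[wX /exists_inP[t tT /connectP[p wp tp]]]|].
  by move: wp; rewrite pathE => /andP[wp pX]; exists p; rewrite /= wX -tp.
move=> [p [wp /= /andP[wX pX] pT]]; split=> //; apply/exists_inP.
by exists (last w p) => //; apply/connectP; exists p => //; rewrite pathE wp.
Qed.

Lemma parents_avoiding_ancestors X T u w :
  e u w -> w \in avoiding_ancestors X T -> u \notin X ->
  u \in avoiding_ancestors X T.
Proof.
move=> uw /avoiding_ancestorsP[p [wp pX pT]] uX; apply/avoiding_ancestorsP.
by exists (w :: p); rewrite /= uw wp uX.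
Qed.

Lemma avoiding_ancestors_sub X T w :
  w \in avoiding_ancestors X T -> w \in ancestors e T.
Proof.
move=> /avoiding_ancestorsP[p [wp _ pT]]; rewrite inE; apply/exists_inP.
by exists (last w p) => //; apply/connectP; exists p.
Qed.

Lemma mem_avoiding_ancestors X T w :
  w \in T -> w \notin X -> w \in avoiding_ancestors X T.
Proof.
by move=> wT wX; apply/avoiding_ancestorsP; exists [::]; rewrite /= wX.
Qed.

Lemma open_given_chain Z u p : path e u p -> {in p, forall v, v \notin Z} ->
  open_given e Z (u :: p).
Proof.
elim: p u => [|v p IH] u /=; first by move=> _ _; apply: open_given_short.
move=> /andP[uv vp] pZ; have pZ' : {in p, forall w, w \notin Z}.
  by move=> w wp; apply: pZ; rewrite inE wp orbT.
case: p vp pZ' IH pZ => [|w p] vp pZ' IH pZ; first exact: open_given_short.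
apply/open_given_cons; split; last exact: IH.
have wv : e w v = false.
  by apply: negbTE; apply: no_two_cycle; case/andP: vp.
by rewrite /triple_open /collider wv andbF pZ ?inE ?eqxx.
Qed.

Lemma open_given_child Z c b p :
  e b c -> b \notin Z -> open_given e Z (b :: p) ->
  open_given e Z (c :: b :: p).
Proof.
move=> bc bZ; case: p => [|a p] op; first exact: open_given_short.
apply/open_given_cons; split=> //.
by rewrite /triple_open /collider (negPf (no_two_cycle bc)).
Qed.

(** * What the two path conditions say about single edges *)

Section Criterion.
Variables X Y Z : {set N}.
Hypothesis disXY : [disjoint X & Y].
Hypothesis disXZ : [disjoint X & Z].
Hypothesis disYZ : [disjoint Y & Z].
Hypothesis no_open_back_door : forall x p,
  path_between e X Z x p -> back_door e x p ->
  ~ open_given e finset.set0 (x :: p).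
Hypothesis no_open_front_door : forall x p,
  path_between e X Y x p -> proper_path X p -> front_door e x p ->
  ~ open_given e Z (x :: p).

Local Notation B := (avoiding_ancestors X Z).
Local Notation C := (avoiding_ancestors X Y).

(** From a common node, go down to Z along a path avoiding X, and prepend the
nodes of the path down to X one at a time until X is reached: the result is a
walk without colliders whose first edge points into X. *)
Lemma ancestors_avoiding_disjoint : [disjoint ancestors e X & B].
Proof.
apply/pred0P => w /=; apply/negP => /andP[].
rewrite inE => /exists_inP[x xX /connectP[p wp xp]].
rewrite {x}xp in xX.
move=> /avoiding_ancestorsP[q [wq qX qZ]].
have walk : path (adjacent e) w q.
  by apply: sub_path wq => u v; rewrite /adjacent => ->.
have {wq} op : open_given e finset.set0 (w :: q).
  by apply: open_given_chain wq _ => v _; rewrite inE.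
elim: p w q wp xX walk op qX qZ => [|c p IH] w q /=.
  by move=> _ wX _ _ /andP[]; rewrite wX.
move=> /andP[wc cp] lastX walk op qX qZ.
have walk' : path (adjacent e) c (w :: q) by rewrite /= walk /adjacent wc orbT.
have op' : open_given e finset.set0 (c :: w :: q).
  by apply: open_given_child; rewrite ?inE.
have [cX|cX] := boolP (c \in X); last first.
  by apply: IH cp lastX walk' op' _ _; rewrite //= cX.
have cq : c \notin w :: q.
  by apply/negP => /(allP (qX : all _ (w :: q))); rewrite cX.
have [p' [path' last' head' _ op'']] := open_walk_to_path walk' cq op'.
apply: (no_open_back_door _ _ op'').
  by rewrite /path_between path' cX last'.
case: p' head' {path' last' op''} => [|v p'] //= [->].
exact: no_two_cycle.
Qed.

Definition connection h p := [/\ path (adjacent e) h p,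
  all (fun v => v \notin X) (h :: p), last h p \in Y & open_given e Z (h :: p)].

(** An open connection of w to Y extends to a parent u of w. The one obstacle is
that w becomes a collider that is not above Z; then w is above Y, and the
directed path from w to Y avoids Z and can replace the connection. The last
hypothesis keeps w from being a non-collider in Z. *)
Lemma connection_parent u w p : e u w -> w \in B :|: C -> connection w p ->
  w \notin Z \/ (exists h q, p = h :: q /\ e h w) ->
  exists2 q, connection w q & open_given e Z (u :: w :: q).
Proof.
move=> uw wBC wp; case: p wp => [|h p] wp wZ.
  by exists [::] => //; apply: open_given_short.
have [hw|nhw] := boolP (e h w); last first.
  exists (h :: p) => //; apply/open_given_cons; split; last by case: wp.
  rewrite /triple_open /collider (negPf nhw) andbF.
  by case: wZ => // -[h' [q [[<- _] hw]]]; rewrite hw in nhw.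
have [wAn|wAn] := boolP (w \in ancestors e Z).
  exists (h :: p) => //; apply/open_given_cons; split; last by case: wp.
  by rewrite /triple_open /collider uw hw.
(* The walk is blocked at the collider w: continue along arrows to Y. *)
have wC : w \in C.
  move: wBC; rewrite inE => /orP[/avoiding_ancestors_sub|//].
  by rewrite (negPf wAn).
have /avoiding_ancestorsP[q [wq qX qY]] := wC.
have qZ : {in w :: q, forall v, v \notin Z}.
  move=> v vq; apply: contra wAn => vZ.
  rewrite inE; apply/exists_inP; exists v => //.
  by apply: path_connect wq _ _.
exists q; last by apply: open_given_chain; rewrite //= uw.
split=> //; first by apply: sub_path wq => a b; rewrite /adjacent => ->.
by apply: open_given_chain => // v vq; apply: qZ; rewrite inE vq orbT.
Qed.

(** Every node joined to Y in the moral graph of B and C with Z deleted belongs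
to this set; the description by walks makes the moral graph dispensable. *)
Definition response : {set N} :=
  [set h | [&& h \in B :|: C, h \notin Z
    & `[< exists p, connection h p >]]]%SET.

Lemma responseP h : reflect
  [/\ h \in B :|: C, h \notin Z & exists p, connection h p] (h \in response).
Proof.
rewrite [h \in response]finset.in_set.
by apply: (iffP and3P) => -[hBC hZ hp]; split=> //; apply/asboolP.
Qed.

(** If u were in X, the extended connection would be an open proper front-door
walk from X to Y. *)
Lemma connection_parent_response u w p : e u w -> w \in B :|: C ->
  connection w p -> w \notin Z \/ (exists h q, p = h :: q /\ e h w) ->
  u \in response :|: Z.
Proof.
move=> uw wBC wp wZ; have [q wq op] := connection_parent uw wBC wp wZ.
have walk : path (adjacent e) u (w :: q).
  by case: wq => wq _ _ _; rewrite /= wq /adjacent uw.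
have [uX|uX] := boolP (u \in X).
  exfalso; have [_ qX qY _] := wq.
  have uq : u \notin w :: q.
    by apply/negP => /(allP qX); rewrite uX.
  have [p' [path' last' head' sub' op']] := open_walk_to_path walk uq op.
  apply: (no_open_front_door _ _ _ op').
  - by rewrite /path_between path' uX last'.
  - by apply/allP => v /sub' /(allP qX).
  - by case: (p') head' => //= v p'' [->].
rewrite finset.in_setU; have [//|uZ] := boolP (u \in Z); first by rewrite orbT.
rewrite orbF; apply/responseP; split=> //.
  move: wBC; rewrite !finset.in_setU.
  by case/orP => /(parents_avoiding_ancestors uw)/(_ uX) ->; rewrite ?orbT.
exists (w :: q); case: wq => [_ qX qY _].
by split=> //=; rewrite uX.
Qed.

Lemma connection_child h w : e h w -> h \in response -> w \notin X ->
  exists p, connection w (h :: p).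
Proof.
move=> hw /responseP[_ hZ [p [hp pX pY op]]] wX; exists p; split=> //=.
- by rewrite /adjacent hw orbT.
- by rewrite wX.
- exact: open_given_child.
Qed.

(** The nodes of Z whose factor involves the response: conditioning on them
couples their parents, so none of these parents is in X. *)
Definition response_conditioned : {set N} :=
  [set z in Z | ~~ [disjoint parents e z & response]]%SET.

Lemma disjoint_response_Z : [disjoint response & Z].
Proof.
by apply/pred0P => w /=; apply/negP => /andP[/responseP[_ /negPf->]].
Qed.

Lemma disjoint_response_X : [disjoint response & X].
Proof.
apply/pred0P => w /=; apply/negP => /andP[/responseP[_ _ [p [_ pX _ _]]]].
by move: pX => /= /andP[/negPf->].
Qed.

Lemma sub_avoiding_ancestors : Z \subset B.
Proof.
apply/fintype.subsetP => z zZ; apply: mem_avoiding_ancestors => //.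
by rewrite (disjointFl disXZ zZ).
Qed.

Lemma sub_Y_response : Y \subset response.
Proof.
apply/fintype.subsetP => y yY.
have yX : y \notin X by rewrite (disjointFl disXY yY).
apply/responseP; split.
- by rewrite finset.in_setU [y \in C]mem_avoiding_ancestors ?orbT.
- by rewrite (disjointFr disYZ yY).
- exists [::]; split=> //=; first by rewrite yX.
  exact: open_given_short.
Qed.

Lemma closed_avoiding_ancestors : closed_under_parents e B (B :|: X).
Proof.
move=> w wB; apply/fintype.subsetP => u; rewrite inE => uw.
rewrite finset.in_setU; have [|uX] := boolP (u \in X); first by rewrite orbT.
by rewrite (parents_avoiding_ancestors uw).
Qed.

(** Besides nodes of the response, [connection_parent_response] applies to a
node of Z with a parent h in the response: a connection of h extends to it by an
edge that points into it. *)
Lemma closed_response :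
  closed_under_parents e (response :|: response_conditioned) (response :|: Z).
Proof.
move=> w; rewrite finset.in_setU => wHZ.
apply/fintype.subsetP => u; rewrite inE => uw.
case/orP: wHZ => [/responseP[wBC wZ [p wp]]|].
  exact: (connection_parent_response uw wBC wp (or_introl wZ)).
rewrite inE => /andP[wZ /pred0Pn[h /= /andP[]]]; rewrite inE => hw hH.
have wB := fintype.subsetP sub_avoiding_ancestors w wZ.
have wX : w \notin X by move: wB; rewrite inE => /andP[].
have [p wp] := connection_child hw hH wX.
apply: (connection_parent_response uw _ wp); first by rewrite finset.in_setU wB.
by right; exists h, p.
Qed.

(** Outside Z, a child in B of a node of the response is in the response. *)
Lemma parents_unresponsive w :
  w \in B :\: (response :|: response_conditioned) ->
  [disjoint parents e w & response].
Proof.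
rewrite finset.in_setD finset.in_setU negb_or => /andP[/andP[wH wZH] wB].
apply/negPn; apply: contra wH => npw.
have wZ : w \notin Z.
  by apply: contra wZH => wZ; rewrite inE wZ.
move/pred0Pn: npw => [h /= /andP[]]; rewrite inE => hw hH.
have wX : w \notin X by move: wB; rewrite inE => /andP[].
have [p wp] := connection_child hw hH wX.
by apply/responseP; split=> //; [rewrite finset.in_setU wB|exists (h :: p)].
Qed.

End Criterion.

End Graph.

(** * Factoring the joint law *)

Lemma mule_bounded (R : realType) (x y : \bar R) :
  0 <= x -> 0 <= y -> 0 < x * y < +oo ->
  exists u v : R, [/\ (0 < u)%R, (0 < v)%R, x = u%:E & y = v%:E].
Proof.
move=> x0 y0 /andP[xy0 xyoo].
have xn0 : 0 < x.
  by rewrite lt0e x0 andbT; apply: contraTneq xy0 => ->; rewrite mul0e ltxx.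
have yn0 : 0 < y.
  by rewrite lt0e y0 andbT; apply: contraTneq xy0 => ->; rewrite mule0 ltxx.
case: x y x0 y0 xy0 xyoo xn0 yn0 => [u||] [v||] // _ _ _.
- by move=> _; rewrite !lte_fin => u0 v0; exists u, v.
- by move=> + u0; rewrite gt0_muley.
- by move=> + _ v0; rewrite gt0_mulye.
Qed.

Lemma cancel_mediator (R : realType) (o : \bar R) (u v w : R) :
  (0 < u)%R -> (0 < v)%R -> (0 < w)%R ->
  o * w%:E / (u%:E * (v%:E * w%:E)) * u%:E = v%:E^-1 * o.
Proof.
move=> u0 v0 w0; rewrite -!EFinM !inver !mulf_eq0 !gt_eqF //= -!muleA -!EFinM.
rewrite muleC; congr (_ * o); congr EFin.
by field; rewrite !gt_eqF.
Qed.

Lemma cancel_response (R : realType) (o : \bar R) (u v w : R) :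
  (0 < u)%R -> (0 < v)%R ->
  o * w%:E = u%:E * (v%:E * w%:E) / u%:E * (o / v%:E).
Proof.
move=> u0 v0; rewrite !inver !gt_eqF // -!EFinM muleCA -EFinM.
by congr (o * _); congr EFin; field; rewrite !gt_eqF.
Qed.

(** The probabilistic half of the argument uses the graph only through the sets
below: A stands for the ancestors of X, B for the nodes with a directed path
to Z avoiding X, H for the response, and ZH for the nodes of Z that have a
parent in H. *)
Section Decomposition.
Variables (R : realType) (N : finType) (e : rel N) (D : N -> countType).
Variable k : factors R e D.
Hypothesis e_acyclic : acyclic e.
Hypothesis k_distribution : forall w pa, distribution_on (@k w pa).
Variables X Y Z A B H ZH : {set N}.
Hypothesis subXA : X \subset A.
Hypothesis subZB : Z \subset B.
Hypothesis subYH : Y \subset H.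
Hypothesis subZHZ : ZH \subset Z.
Hypothesis disAB : [disjoint A & B].
Hypothesis disHX : [disjoint H & X].
Hypothesis disHZ : [disjoint H & Z].
Hypothesis paA : closed_under_parents e A A.
Hypothesis paB : closed_under_parents e B (B :|: X).
Hypothesis paH : closed_under_parents e (H :|: ZH) (H :|: Z).
Hypothesis paB_H :
  forall w, w \in B :\: (H :|: ZH) -> [disjoint parents e w & H].

Local Notation fp := (factor_prod k).

Let membership w :
  [&& (w \in X) ==> (w \in A), (w \in Z) ==> (w \in B),
      (w \in Y) ==> (w \in H), (w \in ZH) ==> (w \in Z),
      ~~ ((w \in A) && (w \in B)), ~~ ((w \in H) && (w \in X)) &
      ~~ ((w \in H) && (w \in Z))].
Proof.
have sub (S T : {set N}) : S \subset T -> (w \in S) ==> (w \in T).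
  by move=> ST; apply/implyP/(fintype.subsetP ST).
have dis (S T : {set N}) : [disjoint S & T] -> ~~ ((w \in S) && (w \in T)).
  by move=> dST; apply/negP => /andP[wS]; rewrite (disjointFr dST wS).
by rewrite !sub ?dis.
Qed.

Local Ltac decide_membership w :=
  rewrite ?inE; move: (membership w);
  repeat match goal with
  | |- context [w \in ?S] => case: (w \in S) => //=
  end.

Local Ltac set_eq :=
  let w := fresh in apply/setP; intro w; decide_membership w.
Local Ltac set_sub :=
  rewrite ?finset.disjoints_subset; apply/fintype.subsetP;
  let w := fresh in intro w; decide_membership w.

Let paB' : closed_under_parents e (B :\: (H :|: ZH)) ((B :\: H) :|: X).
Proof.
move=> w wBH; apply/fintype.subsetP => u uw.
have := fintype.subsetP (paB _) u uw; rewrite !inE.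
rewrite (disjointFr (paB_H wBH) uw) => -> //.
by move: wBH; rewrite inE => /andP[].
Qed.

Let fp_ge0 T (a : assignment D) : 0 <= fp T a :=
  factor_prod_ge0 k_distribution T a.

(** The factors that involve H, as a function of Z and of the part Y' of H that
is not summed: Y for the response itself, and the empty set for its
normalization. *)
Definition response_mass (Y' : {set N}) := sum_out (H :\: Y') (fp (H :|: ZH)).

(** The remaining factors of B, as a function of X and Z. *)
Definition mediator_mass := sum_out (B :\: (H :|: Z)) (fp (B :\: (H :|: ZH))).

Let dep_H : depends_on (H :|: Z) (fp (H :|: ZH)).
Proof. by apply: depends_on_factor_prod => //; set_sub. Qed.

Let dep_B : depends_on ((B :\: H) :|: X) (fp (B :\: (H :|: ZH))).
Proof. by apply: depends_on_factor_prod => //; set_sub. Qed.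

Lemma depends_on_response_mass : depends_on Z (response_mass finset.set0).
Proof.
have := depends_on_sum_out (S := H :\: finset.set0) dep_H.
by apply: depends_onW; set_sub.
Qed.

(** Nodes outside X, H and B are barren once the factors of X are removed; the
other factors fall into two groups that share only Z. *)
Lemma truncated_sum_out (Y' : {set N}) a : Y' \subset H ->
  sum_out (~: (X :|: Y' :|: Z)) (fp (~: X)) a =
  response_mass Y' a * mediator_mass a.
Proof.
move=> subY'H; have Y'H w : (w \in Y') ==> (w \in H).
  by apply/implyP/(fintype.subsetP subY'H).
rewrite (@sum_out_barren _ _ _ _ _ _ _ (~: (X :|: H :|: B))) //; first last.
- move=> w; rewrite !inE => wHB; rewrite finset.disjoints_subset finset.setCK.
  have [wH|wH] := boolP (w \in H).
    apply: fintype.subset_trans (paH _) _; rewrite ?inE ?wH //; set_sub.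
  apply: fintype.subset_trans (paB _) _; last set_sub.
  by move: wHB wH; decide_membership w.
- by set_sub.
- apply/fintype.subsetP => w; move: (Y'H w); rewrite !inE.
  by decide_membership w.
rewrite (_ : _ :\: _ = (H :\: Y') :|: (B :\: (H :|: Z))); last first.
  apply/setP => w; move: (Y'H w); rewrite !inE.
  by decide_membership w.
rewrite (_ : (~: X) :\: _ = (H :|: ZH) :|: (B :\: (H :|: ZH))); last set_eq.
rewrite -(sum_out_mul _ dep_H dep_B) //; try set_sub.
by apply: eq_sum_out => b; rewrite factor_prodU //; set_sub.
Qed.

(** The factors that involve H together with those of the ancestors of X. *)
Definition observed_mass :=
  sum_out ((H :|: A) :\: (X :|: Y)) (fp ((H :|: ZH) :|: (A :\: H))).

(** With the factors of X restored, the ancestors of X are no longer barren, but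
they join the group of H and leave that of B untouched. *)
Lemma joint_sum_out a :
  sum_out (~: (X :|: Y :|: Z)) (fp [set: N]%SET) a =
  observed_mass a * mediator_mass a.
Proof.
rewrite (@sum_out_barren _ _ _ _ _ _ _ (~: (A :|: H :|: B))) //; first last.
- move=> w; rewrite !inE => wHB; rewrite finset.disjoints_subset finset.setCK.
  have [wH|wH] := boolP (w \in H).
    apply: fintype.subset_trans (paH _) _; rewrite ?inE ?wH //; set_sub.
  have [wA|wA] := boolP (w \in A).
    apply: fintype.subset_trans (paA wA) _; set_sub.
  apply: fintype.subset_trans (paB _) _; last set_sub.
  by move: wHB; rewrite (negPf wA) (negPf wH); decide_membership w.
- by set_sub.
rewrite (_ : _ :\: _ =
  ((H :|: A) :\: (X :|: Y)) :|: (B :\: (H :|: Z))); last set_eq.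
rewrite (_ : [set: N]%SET :\: _ =
  ((H :|: ZH) :|: (A :\: H)) :|: (B :\: (H :|: ZH))); last set_eq.
have dep_A : depends_on ((H :|: Z) :|: A) (fp ((H :|: ZH) :|: (A :\: H))).
  apply: depends_on_factor_prod; first set_sub.
  move=> w; rewrite finset.in_setU => /orP[/paH|].
    by move/fintype.subset_trans; apply; apply: finset.subsetUl.
  rewrite inE => /andP[_ /paA] /fintype.subset_trans; apply.
  exact: finset.subsetUr.
rewrite -(sum_out_mul _ dep_A dep_B) //; try set_sub.
by apply: eq_sum_out => b; rewrite -factor_prodU //; set_sub.
Qed.

(** After x is summed, all ancestors of X outside H are barren. *)
Lemma sum_out_observed_mass a : sum_out X observed_mass a = response_mass Y a.
Proof.
rewrite -sum_outU //; last set_sub.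
rewrite (@sum_out_barren _ _ _ _ _ _ _ (A :\: H)) //; first last.
- move=> w wHZ; rewrite finset.disjoints_subset.
  apply: fintype.subset_trans (paH _) _; last set_sub.
  by move: wHZ; decide_membership w.
- by set_sub.
- by set_sub.
rewrite (_ : _ :\: _ = H :\: Y); last set_eq.
by rewrite (_ : (_ :|: _) :\: _ = H :|: ZH) //; set_eq.
Qed.

(** As A and B are disjoint, x is produced by A and z by B, the latter using
only x: so P(x, z) = P(x) P(z | do(x)). *)
Lemma mediator_unconfounded a :
  sum_out (~: (X :|: Z)) (fp [set: N]%SET) a =
  sum_out (~: X) (fp [set: N]%SET) a * sum_out (~: (X :|: Z)) (fp (~: X)) a.
Proof.
have paAd w : w \in A -> [disjoint parents e w & ~: A].
  by move=> wA; rewrite finset.disjoints_subset finset.setCK paA.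
have paBd w : w \in B -> [disjoint parents e w & ~: (B :|: X)].
  by move=> wB; rewrite finset.disjoints_subset finset.setCK paB.
rewrite (@sum_out_barren _ _ _ _ _ _ _ (~: (A :|: B))) //; first last.
- move=> w; rewrite !inE andbT negbK => /orP[/paAd|/paBd];
  by apply: fintype.disjointWr; set_sub.
- by set_sub.
rewrite [F in _ = F * _](@sum_out_barren _ _ _ _ _ _ _ (~: A)) //; first last.
- by move=> w; rewrite !inE andbT negbK => /paAd.
- by set_sub.
rewrite [F in _ = _ * F](@sum_out_barren _ _ _ _ _ _ _ (~: (B :|: X))) //;
  first last.
- by move=> w wB; apply: paBd; move: wB; decide_membership w.
- by set_sub.
- by set_sub.
rewrite (_ : ~: (X :|: Z) :\: ~: (A :|: B) = (A :\: X) :|: (B :\: Z));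
  last set_eq.
rewrite (_ : [set: N]%SET :\: ~: (A :|: B) = A :|: B); last set_eq.
rewrite (_ : ~: X :\: ~: A = A :\: X); last set_eq.
rewrite (_ : [set: N]%SET :\: ~: A = A); last set_eq.
rewrite (_ : ~: (X :|: Z) :\: _ = B :\: Z); last set_eq.
rewrite (_ : ~: X :\: _ = B); last set_eq.
have dep_A : depends_on A (fp A) by apply: depends_on_factor_prod.
have dep_B' : depends_on (B :|: X) (fp B).
  by apply: depends_on_factor_prod => //; apply: finset.subsetUl.
rewrite -(sum_out_mul _ dep_A dep_B') //; try set_sub.
by apply: eq_sum_out => b; rewrite factor_prodU //; set_sub.
Qed.

(** Both sides are the sum over z of [response_mass] for y and z times
[mediator_mass]. The bounds ensure that the normalization r(z) of the former
and the latter, m(x, z), cancel from the fractions: they are finite and nonzero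
because P(x) r(z) m(x, z) = P(x, z) is. *)
Lemma front_door_adjustment (a : assignment D) :
  (forall (S : {set N}) b, S \subset X :|: Z ->
    0 < sum_out (~: S) (fp [set: N]%SET) b < +oo) ->
  sum_out (~: (X :|: Y)) (fp (~: X)) a =
  sum_out Z (fun b =>
    sum_out (~: (Z :|: X)) (fp [set: N]%SET) b /
      sum_out (~: X) (fp [set: N]%SET) b *
    sum_out X (fun c =>
      sum_out (~: (Y :|: (Z :|: X))) (fp [set: N]%SET) c /
        sum_out (~: (Z :|: X)) (fp [set: N]%SET) c *
      sum_out (~: X) (fp [set: N]%SET) c) b) a.
Proof.
move=> bounds.
rewrite (_ : ~: (X :|: Y) = Z :|: ~: (X :|: Y :|: Z)); last set_eq.
rewrite sum_outU //; last set_sub.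
apply: eq_sum_out => b; rewrite truncated_sum_out //.
pose r := response_mass finset.set0; pose m := mediator_mass.
have r_ge0 c : 0 <= r c by apply: sum_out_ge0.
have m_ge0 c : 0 <= m c by apply: sum_out_ge0.
have EZX : Z :|: X = X :|: Z by rewrite finset.setUC.
have XZE c : sum_out (~: (Z :|: X)) (fp [set: N]%SET) c =
    sum_out (~: X) (fp [set: N]%SET) c * (r c * m c).
  rewrite EZX mediator_unconfounded //; congr (_ * _).
  by rewrite -truncated_sum_out ?finset.sub0set // finset.setU0.
have pos c : exists x y z : R, [/\ (0 < x)%R, (0 < y)%R, (0 < z)%R,
    sum_out (~: X) (fp [set: N]%SET) c = x%:E & r c = y%:E /\ m c = z%:E].
  have := bounds (Z :|: X) c; rewrite {1}EZX => /(_ (subxx _)).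
  rewrite XZE => XZ_bounds.
  have [||x [s [x0 s0 Ex Es]]] := mule_bounded _ _ XZ_bounds.
  - by apply: sum_out_ge0.
  - exact: mule_ge0.
  have [|y [z [y0 z0 Ey Ez]]] := mule_bounded (r_ge0 c) (m_ge0 c).
    by rewrite Es lte_fin s0 ltry.
  by exists x, y, z.
rewrite (_ : sum_out X _ b = response_mass Y b / r b); last first.
  rewrite -sum_out_observed_mass muleC -esumZl.
  - apply: eq_esum => x _; set c := overwrite x b.
    rewrite (_ : Y :|: (Z :|: X) = X :|: Y :|: Z); last set_eq.
    rewrite joint_sum_out // XZE.
    have -> : r b = r c.
      apply: depends_on_response_mass => w wZ; rewrite overwriteF //.
      by move: wZ; decide_membership w.
    rewrite -/m.
    have [u [v [w [u0 v0 w0 -> [-> ->]]]]] := pos c.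
    exact: cancel_mediator.
  - by rewrite inve_ge0.
  - by move=> c; apply: sum_out_ge0.
rewrite XZE -[mediator_mass b]/(m b).
have [u [v [w [u0 v0 w0 -> [-> ->]]]]] := pos b.
exact: cancel_response.
Qed.

End Decomposition.

(** * The adjustment formula *)

Section Marginals.
Variables (R : realType) (N : finType) (D : N -> countType).
Implicit Types (S T : {set N}) (a b : assignment D).
Variable P : assignment D -> R.
Hypothesis P_distribution : distribution_on P.

Let P_ge0 b : 0 <= (P b)%:E.
Proof. by rewrite lee_fin; have [+ _] := P_distribution; apply. Qed.

Lemma mass_subset (E F : set (assignment D)) : (E `<=` F)%classic ->
  mass P E <= mass P F.
Proof.
move=> EF; rewrite /mass esum_mkcond [leRHS]esum_mkcond; apply: le_esum => b _.
have [/set_mem/EF/mem_set->//|_] := boolP (b \in E).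
by case: ifP.
Qed.

Lemma mass_le1 (E : set (assignment D)) : mass P E <= 1.
Proof. by have [_ <-] := P_distribution; apply: mass_subset. Qed.

Lemma agreeU S T a : agree (S :|: T) a = (agree S a `&` agree T a)%classic.
Proof.
apply/seteqP; split=> b /=.
  by move=> ba; split=> w wS; apply: ba; rewrite inE wS ?orbT.
by move=> [bS bT] w; rewrite inE => /orP[/bS|/bT].
Qed.

Lemma distribution_inhabited : exists a : assignment D, True.
Proof.
have [//|noa] := pselect (exists a : assignment D, True).
have [_] := P_distribution; rewrite esum1; last first.
  by move=> a; case: noa; exists a.
by move/eqP; rewrite eq_sym onee_eq0.
Qed.

Lemma cond_agree S T a :
  cond P (event (Defs.restrict S a)) (event (Defs.restrict T a)) =
  sum_out (~: (S :|: T)) (EFin \o P) a / sum_out (~: T) (EFin \o P) a.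
Proof. by rewrite /cond !event_restrict -agreeU !mass_agree. Qed.

End Marginals.

Lemma do_marginal_sum_out (R : realType) (N : finType) (e : rel N)
    (D : N -> countType) (k : factors R e D) (X Y : {set N}) a :
  do_marginal k (Defs.restrict X a) (Defs.restrict Y a) =
  sum_out (~: (X :|: Y)) (factor_prod k (~: X)) a.
Proof.
rewrite sum_out_agree finset.setCK finset.setUC agreeU esum_mkcondr.
rewrite /do_marginal /marginal event_restrict; apply: eq_esum => b _.
rewrite /do_joint -(event_restrict X a).
have -> : (b \in event (Defs.restrict X a)) =
    (Defs.restrict X b == Defs.restrict X a).
  by apply/idP/eqP; rewrite inE.
case: ifP => // _; congr EFin; apply: eq_bigl => w.
by rewrite inE.
Qed.

Theorem theorem1p1 (R : realType) (N : finType) (e : rel N) (V : {set N})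
    (D : N -> countType) (X Y Z : {set N})
    (e_acyclic : acyclic e)
    (X_observed : X \subset V) (Y_observed : Y \subset V)
    (Z_observed : Z \subset V)
    (disjoint_XY : [disjoint X & Y]) (disjoint_XZ : [disjoint X & Z])
    (disjoint_YZ : [disjoint Y & Z])
    (no_open_back_door : forall (x : N) (p : seq N),
       path_between e X Z x p -> back_door e x p ->
       ~ open_given e finset.set0 (x :: p))
    (no_open_front_door : forall (x : N) (p : seq N),
       path_between e X Y x p -> proper_path X p -> front_door e x p ->
       ~ open_given e Z (x :: p))
    (P : assignment D -> R) (k : factors R e D)
    (P_distribution : distribution_on P)
    (P_factorizes : factorizes P k)
    (P_positive : forall v : values D V, 0 < marginal P v)
    (xstar : values D X) (y : values D Y) :
  do_marginal k xstar y =
  \esum_(z in [set: values D Z])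
     cond P (event z) (event xstar) *
     \esum_(x in [set: values D X])
        cond P (event y) (event z `&` event x)%classic * marginal P x.
Proof.
have [k_cond PE] := P_factorizes.
have k_distribution w pa : distribution_on (@k w pa) by have [] := k_cond w pa.
have PkE : EFin \o P =1 factor_prod k [set: N]%SET.
  by move=> b; rewrite /= PE; congr EFin; apply: eq_bigl => w; rewrite inE.
(* All marginals are read off at completions of one assignment, so that events
   become agreement with that assignment. *)
have [a0 _] := distribution_inhabited P_distribution.
pose a := overwrite xstar (overwrite y a0).
have Ex : xstar = Defs.restrict X a by rewrite overwriteK.
have Ey : y = Defs.restrict Y a.
  by rewrite restrict_overwrite // overwriteK.
have disjoint_ZX : [disjoint Z & X] by rewrite disjoint_sym.
have disjoint_ZY : [disjoint Z & Y] by rewrite disjoint_sym.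
rewrite {1}Ex {1}Ey do_marginal_sum_out.
rewrite (@front_door_adjustment _ _ _ _ _ e_acyclic k_distribution X Y Z
  (ancestors e X) (avoiding_ancestors e X Z) (response e X Y Z)
  (response_conditioned e X Y Z)).
- apply: eq_esum => z _; set b := overwrite z a.
  have Ez : z = Defs.restrict Z b by rewrite overwriteK.
  have {}Ex : xstar = Defs.restrict X b by rewrite restrict_overwrite.
  have {}Ey : y = Defs.restrict Y b by rewrite restrict_overwrite.
  clearbody b; rewrite {1}Ez {1}Ex cond_agree !(eq_sum_out _ PkE).
  congr (_ * _).
  apply: eq_esum => x _; set c := overwrite x b.
  have Exc : x = Defs.restrict X c by rewrite overwriteK.
  have {}Ez : z = Defs.restrict Z c by rewrite restrict_overwrite.
  have {}Ey : y = Defs.restrict Y c by rewrite restrict_overwrite.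
  clearbody c; rewrite Ez Exc Ey !event_restrict -agreeU -!event_restrict.
  by rewrite cond_agree /marginal event_restrict mass_agree !(eq_sum_out _ PkE).
- apply/fintype.subsetP => x xX; rewrite inE; apply/exists_inP.
  by exists x => //; apply: connect0.
- exact: sub_avoiding_ancestors.
- exact: sub_Y_response.
- by apply/fintype.subsetP => z; rewrite inE => /andP[].
- exact: ancestors_avoiding_disjoint.
- exact: disjoint_response_X.
- exact: disjoint_response_Z.
- move=> w wX; apply/fintype.subsetP => u; rewrite inE => uw.
  exact: parent_ancestors uw wX.
- exact: closed_avoiding_ancestors.
- exact: closed_response.
- exact: parents_unresponsive.
- move=> S b SXZ; rewrite -(eq_sum_out _ PkE) -mass_agree; apply/andP; split.
    apply: (lt_le_trans (P_positive (Defs.restrict V b))).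
    rewrite /marginal event_restrict; apply: mass_subset => // c cb w wS.
    apply: cb.
    move: (fintype.subsetP SXZ w wS); rewrite inE.
    by case/orP; apply: fintype.subsetP.
  exact: le_lt_trans (mass_le1 P_distribution _) (ltry _).
Qed.
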